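(* Let $\alpha,\beta$ satisfy $0<\alpha\le\lambda_{\min}(\Sigma)$ and $\lambda_{\max}(\Sigma)\le\beta$, and let $\lambda>0$. Let $(\eta_k)_{k\ge0}$ be learning rates with $\eta\le\eta_k<1/\beta$ for some $\eta>0$, define $\gamma_k$ by $1-\lambda\gamma_k=\gamma_k/\eta_k$ (i.e. $\gamma_k=\eta_k/(1+\lambda\eta_k)$), and set $\gamma:=\eta/(1+\lambda\eta)$. Run the SGD paths $(w_k)$ (learning rates $\eta_k$, for $L$) and $(\hat w_k)$ (learning rates $\gamma_k$, for $L+\lambda R$) described in the context. Define the weighting scheme $P_k:=1-\prod_{i=0}^k(\gamma_i/\eta_i)$, $p_0:=P_0$, $p_k:=P_k-P_{k-1}$ ($k\ge1$), and the averaged iterates $\tilde w_k:=P_k^{-1}\sum_{i=0}^k p_iw_i$. Then: 1. For all $k\ge0$: $P_k\,\mathbb E[\tilde w_k]=\mathbb E[\hat w_k]-(1-P_k)\,\mathbb E[w_k]$. 2. Both $\mathbb E[w_k]$ and $\mathbb E[\hat w_k]$ converge (to $\Sigma^{-1}a$ and $(\Sigma+\lambda I)^{-1}a$ respectively), and there is a constant $C$ such that $\|\mathbb E[\hat w_k]-\mathbb E[\tilde w_k]\|_2\le C(1-\lambda\gamma)^k$ for all $k$. 3. Suppose the gradient noise $\epsilon_k:=(\Sigma w_k-a)-(x_{\xi_{k+1}}x_{\xi_{k+1}}^\top w_k-x_{\xi_{k+1}}y_{\xi_{k+1}})$ satisfies $\mathbb E[\|\epsilon_k\|_2^2]\le\sigma^2$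 for all $k$. Then for every $\delta\in(0,1)$ and all sufficiently large $k$, with probability at least $1-\delta$, $$\|P_k\tilde w_k-P_k\mathbb E[\tilde w_k]\|_2\le \frac{\sigma}{\gamma(\lambda+\alpha)(\lambda+\beta)^2}\sqrt{\frac{\lambda}{\delta\gamma(2-\lambda\gamma)}}.$$
   Context: Data $(x_i,y_i)\in\mathbb R^d\times\mathbb R$, $i=1,\dots,n$. Loss $L(w)=\frac1{2n}\sum_{i=1}^n(w^\top x_i-y_i)^2$, regularizer $R(w)=\frac12\|w\|_2^2$. Write $\Sigma=\frac1n\sum_i x_ix_i^\top$ and $a=\frac1n\sum_i x_iy_i$, so $\nabla L(w)=\Sigma w-a$; $L$ is $\alpha$-strongly convex and $\beta$-smooth under the stated conditions. Let $(\xi_k)_{k\ge1}$ be i.i.d. uniform on $\{1,\dots,n\}$. SGD paths (batch size 1, started at zero): $w_0=\hat w_0=0$, $w_{k+1}=w_k-\eta_k(x_{\xi_{k+1}}x_{\xi_{k+1}}^\top w_k-x_{\xi_{k+1}}y_{\xi_{k+1}})$, $\hat w_{k+1}=\hat w_k-\gamma_k(x_{\xi_{k+1}}x_{\xi_{k+1}}^\top \hat w_k-x_{\xi_{k+1}}y_{\xi_{k+1}}+\lambda\hat w_k)$. *)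

(* Defs.v *)
From HB Require Import structures.
From mathcomp Require Import all_boot all_order all_algebra.
From mathcomp Require Import all_classical all_reals all_analysis.
Set Implicit Arguments. Unset Strict Implicit. Unset Printing Implicit Defensive.
Import Order.TTheory GRing.Theory Num.Theory.
Import numFieldNormedType.Exports.
Local Open Scope ring_scope.

Definition norm2 (R : realType) (d : nat) (v : 'cV[R]_d) : R :=
  Num.sqrt (\sum_(i < d) v i 0 ^+ 2).

Definition Sigma (R : realType) (n d : nat) (X : 'I_n -> 'cV[R]_d) : 'M[R]_d :=
  (n%:R)^-1 *: \sum_(i < n) (X i *m (X i)^T).
Definition avec (R : realType) (n d : nat) (X : 'I_n -> 'cV[R]_d) (Y : 'I_n -> R)
  : 'cV[R]_d := (n%:R)^-1 *: \sum_(i < n) (Y i *: X i).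

(* SGD with batch size 1 on L + lam R, learning rates st k, started at w at
   step k, driven by the list of sampled indices s (s = [:: xi_{k+1}; ...]). *)
Fixpoint sgd_aux (R : realType) (n d : nat) (X : 'I_n -> 'cV[R]_d) (Y : 'I_n -> R)
  (st : nat -> R) (lam : R) (k : nat) (w : 'cV[R]_d) (s : seq 'I_n) : 'cV[R]_d :=
  match s with
  | [::] => w
  | i :: s' => sgd_aux X Y st lam k.+1
                 (w - st k *: (X i *m ((X i)^T *m w) - Y i *: X i + lam *: w)) s'
  end.

Definition sgd_path (R : realType) (n d : nat) (X : 'I_n -> 'cV[R]_d) (Y : 'I_n -> R)
  (st : nat -> R) (lam : R) (s : seq 'I_n) : 'cV[R]_d :=
  sgd_aux X Y st lam 0 0 s.

(* Expectation / probability of quantities depending on xi_1..xi_k, the xi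
   i.i.d. uniform on 'I_n: the law of (xi_1..xi_k) is uniform on k-tuples. *)
Definition Exp (R : realType) (n k : nat) (V : lmodType R) (F : k.-tuple 'I_n -> V) : V :=
  ((n ^ k)%:R)^-1 *: \sum_(t : k.-tuple 'I_n) F t.
Definition Prob (R : realType) (n k : nat) (A : pred (k.-tuple 'I_n)) : R :=
  (#|A|%:R) / ((n ^ k)%:R).

(* gamma_k = eta_k / (1 + lam eta_k), i.e. 1 - lam gamma_k = gamma_k / eta_k. *)
Definition gammas (R : realType) (lam : R) (eta : nat -> R) (k : nat) : R :=
  eta k / (1 + lam * eta k).

Definition Pw (R : realType) (lam : R) (eta : nat -> R) (k : nat) : R :=
  1 - \prod_(i < k.+1) (gammas lam eta i / eta i).
Definition pw (R : realType) (lam : R) (eta : nat -> R) (k : nat) : R :=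
  if k is k'.+1 then Pw lam eta k'.+1 - Pw lam eta k' else Pw lam eta 0.

Definition wtilde (R : realType) (n d : nat) (X : 'I_n -> 'cV[R]_d) (Y : 'I_n -> R)
  (lam : R) (eta : nat -> R) (k : nat) (t : k.-tuple 'I_n) : 'cV[R]_d :=
  (Pw lam eta k)^-1 *:
    \sum_(i < k.+1) (pw lam eta i *: sgd_path X Y eta 0 (take i t)).

Definition gnoise (R : realType) (n d : nat) (X : 'I_n -> 'cV[R]_d) (Y : 'I_n -> R)
  (eta : nat -> R) (k : nat) (t : k.+1.-tuple 'I_n) : 'cV[R]_d :=
  let w := sgd_path X Y eta 0 (take k t) in
  let x := X (tnth t ord_max) in
  let y := Y (tnth t ord_max) in
  (Sigma X *m w - avec X Y) - (x *m (x^T *m w) - y *: x).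

(* Main.v *)
(** In coordinates along real eigenvectors of Sigma, with eigenvalue [s], all mean
    recursions are scalar.  Since [1 - gamma (lam + s) = (1 - lam gamma) (1 - eta s)],
    the gradients of the regularized mean path are those of the unregularized one
    damped by [1 - P_(k-1)]; summation by parts gives the averaging identity, and
    contraction of both mean recursions gives the limits and the geometric rate.
    For the deviation, unrolling [u_(k+1) = (1 - eta s) u_k + eta e_k] and summing
    against the weights [p_k] gives each martingale difference [e_j] a coefficient in
    [[0, lam / (lam + s) * (1 - P_(j-1)) * gamma_j]]; orthogonality of the [e_j], a
    geometric series and Chebyshev's inequality finish the proof, for every [k]. *)
Require Import Defs.
From HB Require Import structures.
From mathcomp Require Import all_boot all_order all_algebra.
From mathcomp Require Import all_classical all_reals all_analysis.
From mathcomp Require Import complex ring lra.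
Set Implicit Arguments. Unset Strict Implicit. Unset Printing Implicit Defensive.
Import Order.TTheory GRing.Theory Num.Theory.
Import numFieldNormedType.Exports.
Local Open Scope ring_scope.
Local Open Scope classical_set_scope.

(** * Real eigenframes of symmetric matrices *)

Lemma complex_sum (R : rcfType) (I : finType) (f : I -> R[i]) :
  \sum_i f i = ((\sum_i complex.Re (f i)) +i* (\sum_i complex.Im (f i)))%C.
Proof. by elim/big_rec3: _ => [//|i x y z _ ->]; case: (f i). Qed.

(* The rows of [F] are the real and imaginary parts of a unitary eigenbasis of the
   complexification of [S]: a tight frame of eigenvectors is all that is needed. *)
Lemma symmetric_eigenframe (R : rcfType) (d : nat) (S : 'M[R]_d) : S^T = S ->
  exists (F : 'M[R]_(d + d, d)) (s : 'I_(d + d) -> R),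
    [/\ F^T *m F = 1%:M, F *m S = diag_mx (\row_i s i) *m F
      & forall i, eigenvalue S (s i)].
Proof.
move=> Ssym; pose C : numClosedFieldType := R[i].
pose A : 'M[C]_d := map_mx (real_complex R) S.
have Aherm : A \is hermsymmx.
  apply: realsym_hermsym; last by apply/mxOverP => i j; rewrite mxE complex_real.
  apply/is_hermitianmxP; rewrite expr0 scale1r -map_trmx /A.
  by apply/matrixP => i j; rewrite !mxE -{1}Ssym mxE.
have Dreal := hermitian_spectral_diag_real Aherm.
have /hermitian_normalmx /orthomx_spectralP Aeq := Aherm.
have Pu := spectral_unit A.
have PPt : (map_mx Num.conj (spectralmx A)^T) *m spectralmx A = 1%:M.
  by rewrite -invmx_unitary ?spectral_unitarymx// mulVmx.
have PA : spectralmx A *m A = diag_mx (spectral_diag A) *m spectralmx A.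
  by rewrite [X in _ *m X = _]Aeq mulmxA mulmxA mulmxV ?mul1mx.
move: (spectralmx A) (spectral_diag A) Dreal Pu PPt PA => P D Dreal Pu PPt PA.
pose t i := complex.Re (D 0 i).
have tD i : D 0 i = (t i)%:C%C.
  by rewrite RRe_real//; move/mxOverP: Dreal.
pose B := map_mx (@complex.Re R) P; pose E := map_mx (@complex.Im R) P.
(* Since [S] and the spectrum are real, the complex identity [PA] splits into one identity for the
   real parts [B] and the same one for the imaginary parts [E]. *)
have BEA i j : \sum_k (B i k * S k j) = t i * B i j /\
               \sum_k (E i k * S k j) = t i * E i j.
  move/matrixP: PA => /(_ i j); rewrite mul_diag_mx !mxE tD complex_sum.
  case: (P i j) => x y /= [].
  rewrite !mul0r subr0 addr0 => <- <-.
  by split; apply: eq_bigr => k _; rewrite !mxE; case: (P i k) => u v /=;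
    rewrite !mulr0 ?subr0 ?add0r.
(* This is the real part of unitarity; it says that [B] and [E] stacked form a tight frame. *)
have BE1 i j : \sum_k (B k i * B k j) + \sum_k (E k i * E k j) = (i == j)%:R.
  move/matrixP: PPt => /(_ i j); rewrite !mxE complex_sum => /(congr1 (@complex.Re R)) /=.
  rewrite -big_split /= => h; transitivity (complex.Re ((i == j)%:R : R[i])).
    rewrite -h; apply: eq_bigr => k _; rewrite !mxE.
    by case: (P k i) => u v; case: (P k j) => u' v' /=; rewrite mulNr opprK.
  by case: (i == j).
(* Row [i] of the invertible [P] is nonzero, so its real or its imaginary part is a genuine real
   eigenvector. *)
have tS i : eigenvalue S (t i).
  apply/eigenvalueP; have [B0|B0] := eqVneq (row i B) 0; last first.
    exists (row i B) => //; apply/rowP => j; rewrite !mxE; have [+ _] := BEA i j.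
    by rewrite !mxE => <-; apply: eq_bigr => k _; rewrite !mxE.
  exists (row i E).
    apply/rowP => j; rewrite !mxE; have [_] := BEA i j.
    by rewrite !mxE => <-; apply: eq_bigr => k _; rewrite !mxE.
  apply/negP => /eqP E0; have : row i P = 0.
    apply/rowP => j; move/rowP: B0 => /(_ j); move/rowP: E0 => /(_ j).
    by rewrite !mxE; case: (P i j) => x y /= -> ->.
  rewrite rowE => /(congr1 (mulmx^~ (invmx P))); rewrite mulmxK// mul0mx.
  move/rowP/(_ i); rewrite !mxE !eqxx => /eqP.
  by rewrite oner_eq0.
exists (col_mx B E), (fun i => match fintype.split i with inl j => t j | inr j => t j end).
split=> [||i]; last by case: fintype.split.
  rewrite tr_col_mx mul_row_col; apply/matrixP => i j; rewrite [RHS]mxE -BE1 !mxE.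
  by congr (_ + _); apply: eq_bigr => k _; rewrite !mxE.
apply/matrixP => i j; rewrite mul_diag_mx [RHS]mxE [X in _ = X * _]mxE.
rewrite mul_col_mx -(splitK i); case: (fintype.split i) => k /=.
  by rewrite (unsplitK (inl k)) !col_mxEu !mxE; have [+ _] := BEA k j; rewrite !mxE.
by rewrite (unsplitK (inr k)) !col_mxEd !mxE; have [_] := BEA k j; rewrite !mxE.
Qed.

(** * The Euclidean norm *)

Section Norm2.
Variables (R : realType) (d : nat).
Implicit Types u v : 'cV[R]_d.

Lemma norm2_ge0 v : 0 <= norm2 v. Proof. exact: sqrtr_ge0. Qed.

Lemma sqr_norm2 v : norm2 v ^+ 2 = \sum_i v i 0 ^+ 2.
Proof. by rewrite sqr_sqrtr// sumr_ge0// => i _; exact: sqr_ge0. Qed.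

Lemma norm2_le v (c : R) : 0 <= c -> norm2 v ^+ 2 <= c ^+ 2 -> norm2 v <= c.
Proof. by move=> c0; rewrite ler_sqr// nnegrE norm2_ge0. Qed.

Lemma norm2Z (c : R) v : norm2 (c *: v) = `|c| * norm2 v.
Proof.
rewrite /norm2 -sqrtr_sqr -sqrtrM ?sqr_ge0// mulr_sumr; congr Num.sqrt.
by apply: eq_bigr => i _; rewrite mxE exprMn.
Qed.

Lemma norm2_coord_le (c : R) u v : 0 <= c ->
  (forall i, `|u i 0| <= c * `|v i 0|) -> norm2 u <= c * norm2 v.
Proof.
move=> c0 uv; apply: norm2_le; first by rewrite mulr_ge0// norm2_ge0.
rewrite exprMn !sqr_norm2 mulr_sumr ler_sum// => i _.
rewrite -[leLHS]real_normK ?num_real// -[v i 0 ^+ 2]real_normK ?num_real//.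
by rewrite -exprMn lerXn2r// nnegrE// mulr_ge0.
Qed.

(** A cheap substitute for the triangle inequality, from [(x + y)^2 <= 2 x^2 + 2 y^2] in each
    coordinate; the lost factor only enters the unspecified constant of the second claim. *)
Lemma norm2D_le u v : norm2 (u + v) <= 2 * (norm2 u + norm2 v).
Proof.
have u0 := norm2_ge0 u; have v0 := norm2_ge0 v.
apply: norm2_le; first by rewrite mulr_ge0// addr_ge0.
have : norm2 (u + v) ^+ 2 <= 2 * norm2 u ^+ 2 + 2 * norm2 v ^+ 2.
  rewrite !sqr_norm2 !mulr_sumr -big_split ler_sum// => i _.
  by rewrite mxE /=; have := sqr_ge0 (u i 0 - v i 0); nra.
nra.
Qed.

Lemma norm2_isometry (m : nat) (F : 'M[R]_(m, d)) v :
  F^T *m F = 1%:M -> norm2 (F *m v) = norm2 v.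
Proof.
have normE k (x : 'cV[R]_k) : norm2 x = Num.sqrt ((x^T *m x) 0 0).
  by rewrite /norm2 mxE; congr Num.sqrt; apply: eq_bigr => i _; rewrite mxE expr2.
by move=> FF; rewrite !normE trmx_mul mulmxA -(mulmxA v^T) FF mulmx1.
Qed.

End Norm2.

(** * Linear maps in eigenframe coordinates *)

Section Eigenframe.
Variables (R : realType) (m d : nat) (F : 'M[R]_(m, d)) (S : 'M[R]_d).
Variable s : 'I_m -> R.
Hypotheses (FF : F^T *m F = 1%:M) (FS : F *m S = diag_mx (\row_i s i) *m F).

Lemma eigenframe_coord (v : 'cV[R]_d) i :
  (F *m (S *m v)) i 0 = s i * (F *m v) i 0.
Proof. by rewrite mulmxA FS -mulmxA mul_diag_mx !mxE. Qed.

(** Inverting the eigenvalues inside the frame, [F^T *m diag(1 / s) *m F], gives a left inverse. *)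
Lemma eigenframe_unitmx : (forall i, s i != 0) -> S \in unitmx.
Proof.
move=> s0; have: F^T *m diag_mx (\row_i (s i)^-1) *m F *m S = 1%:M.
  rewrite -!mulmxA FS -FF; congr (_ *m _); rewrite mulmxA mulmx_diag -[RHS]mul1mx.
  by congr (_ *m _); apply/matrixP => i j; rewrite !mxE mulVf.
by case/mulmx1_unit.
Qed.

(** In frame coordinate [i] the step is multiplication by [1 - tau k * s i], and the frame preserves
    norms. *)
Lemma eigenframe_contraction (r : R) (tau : nat -> R) (v : nat -> 'cV[R]_d) k :
  0 <= r -> (forall k i, `|1 - tau k * s i| <= r) ->
  (forall k, v k.+1 = v k - tau k *: (S *m v k)) ->
  norm2 (v k) <= r ^+ k * norm2 (v 0%N).
Proof.
move=> r0 taur vS; elim: k => [|k IHk]; first by rewrite mul1r.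
apply: (@le_trans _ _ (r * norm2 (v k))); last first.
  by rewrite exprS -mulrA ler_wpM2l.
rewrite -(norm2_isometry (v k.+1) FF) -(norm2_isometry (v k) FF).
apply: norm2_coord_le => // i; rewrite vS mulmxBr -scalemxAr mxE [X in _ + X]mxE.
rewrite [X in _ - X]mxE eigenframe_coord.
set x := (F *m v k) i 0; have -> : x - tau k * (s i * x) = (1 - tau k * s i) * x by ring.
by rewrite normrM ler_wpM2r.
Qed.

End Eigenframe.

(** * Expectation over i.i.d. uniform indices *)

Section Expectation.
Variables (R : realType) (n : nat).

Lemma eq_Exp k (V : lmodType R) (F G : k.-tuple 'I_n -> V) : F =1 G -> Exp F = Exp G.
Proof. by move=> FG; rewrite /Exp (eq_bigr G). Qed.

Lemma Exp_linear k (V W : lmodType R) (f : {linear V -> W}) (F : k.-tuple 'I_n -> V) :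
  Exp (fun t => f (F t)) = f (Exp F).
Proof. by rewrite /Exp linearZ_LR (linear_sum f). Qed.

Lemma ExpD k (V : lmodType R) (F G : k.-tuple 'I_n -> V) :
  Exp (fun t => F t + G t) = Exp F + Exp G.
Proof. by rewrite /Exp big_split scalerDr. Qed.

Lemma ExpZ k (V : lmodType R) c (F : k.-tuple 'I_n -> V) :
  Exp (fun t => c *: F t) = c *: Exp F.
Proof. by rewrite /Exp -scaler_sumr !scalerA mulrC. Qed.

Lemma ExpB k (V : lmodType R) (F G : k.-tuple 'I_n -> V) :
  Exp (fun t => F t - G t) = Exp F - Exp G.
Proof. by rewrite /Exp big_split sumrN scalerBr. Qed.

Lemma Exp_sum k (V : lmodType R) (I : finType) (F : I -> k.-tuple 'I_n -> V) :
  Exp (fun t => \sum_i F i t) = \sum_i Exp (F i).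
Proof. by rewrite /Exp exchange_big scaler_sumr. Qed.

Lemma Exp0 (V : lmodType R) (F : 0.-tuple 'I_n -> V) : Exp F = F [tuple].
Proof.
rewrite /Exp expn0 invr1 scale1r (big_pred1 [tuple])// => t.
by symmetry; apply/eqP/val_inj; rewrite (tuple0 t).
Qed.

(** The tower property: condition on the first [k] indices and average over the last. The bijection
    is [(t, i) |-> rcons t i]. *)
Lemma Exp_rcons k (V : lmodType R) (F : k.+1.-tuple 'I_n -> V) :
  Exp F = Exp (fun t : k.-tuple 'I_n => n%:R^-1 *: \sum_i F [tuple of rcons t i]).
Proof.
rewrite /Exp -scaler_sumr scalerA -invfM -natrM -expnSr; congr (_ *: _).
rewrite pair_big /=.
pose h (p : k.-tuple 'I_n * 'I_n) : k.+1.-tuple 'I_n := [tuple of rcons p.1 p.2].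
pose g (t : k.+1.-tuple 'I_n) : k.-tuple 'I_n * 'I_n :=
  ([tuple of belast (thead t) [tuple of behead t]], last (thead t) (behead t)).
rewrite (reindex h)//=; exists g => [[t i] _|t _].
  rewrite /g/h /=; congr pair; [apply: val_inj|]; case: t => [[|x s] hs] //=.
  all: rewrite ?belast_rcons ?last_rcons //.
by apply: val_inj; rewrite /= -lastI; case/tupleP: t => x t /=; rewrite theadE.
Qed.

Lemma Exp_cst k (V : lmodType R) (v : V) : (0 < n)%N -> Exp (fun _ : k.-tuple 'I_n => v) = v.
Proof.
move=> n0; rewrite /Exp sumr_const card_tuple card_ord -[X in _ *: X]scaler_nat scalerA.
by rewrite mulVf ?scale1r// pnatr_eq0 -lt0n expn_gt0 n0.
Qed.

(** Marginalization: the later indices are averaged out one at a time, which lets iterates of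
    different ages be compared on one probability space. *)
Lemma Exp_take j k (V : lmodType R) (G : seq 'I_n -> V) : (0 < n)%N -> (j <= k)%N ->
  Exp (fun t : k.-tuple 'I_n => G (take j t)) = Exp (fun t : j.-tuple 'I_n => G t).
Proof.
move=> n0; elim: k => [|k IHk].
  by rewrite leqn0 => /eqP ->; apply: eq_Exp => t; rewrite take0 tuple0.
rewrite leq_eqVlt => /predU1P[->|jk].
  by apply: eq_Exp => t; rewrite take_oversize// size_tuple.
rewrite Exp_rcons -IHk//; apply: eq_Exp => t.
under eq_bigr do rewrite /= -cats1 takel_cat ?size_tuple//.
by rewrite sumr_const card_ord -[X in _ *: X]scaler_nat scalerA mulVf ?scale1r// pnatr_eq0 -lt0n.
Qed.

Lemma le_Exp k (F G : k.-tuple 'I_n -> R^o) : (forall t, F t <= G t) ->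
  (Exp F : R) <= Exp G.
Proof. by move=> FG; rewrite /Exp ler_wpM2l ?invr_ge0// ler_sum. Qed.

End Expectation.

(** * The SGD recursion and its mean *)

Section StochasticGradient.
Variables (R : realType) (n d : nat) (X : 'I_n -> 'cV[R]_d) (Y : 'I_n -> R).

Definition sample_grad (i : 'I_n) (w : 'cV[R]_d) : 'cV[R]_d :=
  X i *m ((X i)^T *m w) - Y i *: X i.

Lemma sgd_path_rcons (st : nat -> R) lam (s : seq 'I_n) i :
  let w := sgd_path X Y st lam s in
  sgd_path X Y st lam (rcons s i) = w - st (size s) *: (sample_grad i w + lam *: w).
Proof.
(* [sgd_aux] consumes indices from the front, so appending one at the back calls for an induction
   over arbitrary starting step and point. *)
suff h k v : let w := sgd_aux X Y st lam k v s in
    sgd_aux X Y st lam k v (rcons s i) =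
    w - st (k + size s)%N *: (sample_grad i w + lam *: w) by exact: h.
by elim: s k v => [|j s IHs] k v /=; rewrite ?addn0// IHs addSnnS.
Qed.

Lemma mean_sample_grad w :
  n%:R^-1 *: \sum_i sample_grad i w = Sigma X *m w - avec X Y.
Proof.
rewrite /Sigma /avec -scalemxAl -scalerBr; congr (_ *: _).
rewrite mulmx_suml -sumrB; apply: eq_bigr => i _.
by rewrite /sample_grad mulmxA.
Qed.

Lemma Sigma_sym : (Sigma X)^T = Sigma X.
Proof.
rewrite /Sigma linearZ /= linear_sum; congr (_ *: _).
by apply: eq_bigr => i _; rewrite /= trmx_mul trmxK.
Qed.

Hypothesis n0 : (0 < n)%N.

Lemma scaler_mean_cst (V : lmodType R) (v : V) : n%:R^-1 *: (\sum_(i < n) v) = v.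
Proof.
rewrite sumr_const card_ord -[X in _ *: X]scaler_nat scalerA mulVf ?scale1r//.
by rewrite pnatr_eq0 -lt0n.
Qed.

Lemma Exp_sgd_path0 (st : nat -> R) lam :
  Exp (fun t : 0.-tuple 'I_n => sgd_path X Y st lam t) = 0.
Proof. by rewrite Exp0. Qed.

(** The new index is independent of the current iterate and the gradient is affine in it, so the
    mean path is exactly deterministic gradient descent. *)
Lemma Exp_sgd_pathS (st : nat -> R) lam k :
  let m := Exp (fun t : k.-tuple 'I_n => sgd_path X Y st lam t) in
  Exp (fun t : k.+1.-tuple 'I_n => sgd_path X Y st lam t) =
  m - st k *: (Sigma X *m m - avec X Y + lam *: m).
Proof.
move=> m; rewrite Exp_rcons.
pose w (t : k.-tuple 'I_n) := sgd_path X Y st lam t.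
transitivity (Exp (fun t => w t -
    st k *: ((mulmx (Sigma X) (w t) - avec X Y) + lam *: w t))).
  apply: eq_Exp => t; under eq_bigr do rewrite sgd_path_rcons size_tuple.
  rewrite sumrB scalerBr scaler_mean_cst -scaler_sumr scalerA mulrC -scalerA.
  by rewrite big_split scalerDr scaler_mean_cst mean_sample_grad.
rewrite ExpB ExpZ ExpD ExpB (ExpZ lam w) Exp_cst//.
by rewrite (Exp_linear (mulmx (Sigma X))).
Qed.

End StochasticGradient.

(** * The weighting scheme and the mean paths *)

Section Weights.
Variables (R : realType) (lam : R) (eta : nat -> R).
Hypotheses (lam0 : 0 < lam) (eta_gt0 : forall k, 0 < eta k).
Local Notation g := (gammas lam eta).

(** In terms of the weights this is [1 - P_(k-1)], with value 1 at [k = 0]. *)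
Definition decay (k : nat) : R := \prod_(i < k) (g i / eta i).

Lemma gamma_gt0 k : 0 < g k.
Proof. by rewrite divr_gt0// addr_gt0// mulr_gt0. Qed.

Lemma gamma_ratio k : g k / eta k = 1 - lam * g k.
Proof.
have e0 := eta_gt0 k; have h : 1 + lam * eta k != 0.
  by rewrite gt_eqF// addr_gt0// mulr_gt0.
by rewrite /gammas; field; rewrite h gt_eqF.
Qed.

Lemma decayS k : decay k.+1 = decay k * (1 - lam * g k).
Proof. by rewrite /decay big_ord_recr /= gamma_ratio. Qed.

Lemma decayS_eta k : decay k.+1 * eta k = decay k * g k.
Proof. by rewrite /decay big_ord_recr /= -mulrA divfK// gt_eqF. Qed.

Lemma decay_ge0 k : 0 <= decay k.
Proof. by apply: prodr_ge0 => i _; rewrite divr_ge0// ltW// gamma_gt0. Qed.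

Lemma pwE k : pw lam eta k = decay k * (lam * g k).
Proof.
have -> : pw lam eta k = decay k - decay k.+1.
  case: k => [|k]; rewrite /pw /Pw /decay; last by ring.
  by rewrite [X in _ = X - _]big_ord0.
by rewrite decayS; ring.
Qed.

(** Each factor equals [1 / (1 + lam * eta i)], which decreases in [eta i]. *)
Lemma decay_le eta0 k : 0 < eta0 -> (forall k, eta0 <= eta k) ->
  decay k <= (1 - lam * (eta0 / (1 + lam * eta0))) ^+ k.
Proof.
move=> e0 eta_ge; have -> : 1 - lam * (eta0 / (1 + lam * eta0)) = (1 + lam * eta0)^-1.
  by field; rewrite gt_eqF// addr_gt0// mulr_gt0.
rewrite -[X in _ <= _ ^+ X]card_ord -prodr_const; apply: ler_prod => i _.
rewrite divr_ge0 ?(ltW (gamma_gt0 i)) ?(ltW (eta_gt0 i))//=.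
rewrite /gammas mulrAC divff ?gt_eqF// mul1r lef_pV2 ?posrE ?addr_gt0 ?mulr_gt0//.
by rewrite lerD2l ler_wpM2l// ltW.
Qed.

(* The regularized residual is the unregularized one, damped by the weights;
   hence the increments of [h] are those of [m] times [decay]. *)
Lemma mean_path_residual (d : nat) (S : 'M[R]_d) (a : 'cV[R]_d) (m h : nat -> 'cV[R]_d) k :
  m 0%N = 0 -> h 0%N = 0 ->
  (forall k, m k.+1 = m k - eta k *: (S *m m k - a)) ->
  (forall k, h k.+1 = h k - g k *: (S *m h k - a + lam *: h k)) ->
  S *m h k - a + lam *: h k = decay k *: (S *m m k - a).
Proof.
move=> m0 h0 mS hS; elim: k => [|k IHk].
  by rewrite m0 h0 mulmx0 scaler0 addr0 /decay big_ord0 scale1r.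
rewrite mS hS IHk; set D := S *m m k - a.
rewrite !mulmxBr -!scalemxAr -(addrAC (S *m m k)) -/D.
have -> : S *m h k = decay k *: D + a - lam *: h k by rewrite -IHk [X in X - _]addrAC subrK addrK.
move: D (S *m D) => D E; apply/colP => i; rewrite !mxE.
have -> : decay k.+1 * (D i 0 - eta k * E i 0) =
    decay k.+1 * D i 0 - decay k.+1 * eta k * E i 0 by ring.
by rewrite decayS_eta decayS; ring.
Qed.

(** Summation by parts as an induction: [decayS_eta] turns the increment of [h] into [decay k.+1]
    times that of [m], and [pw k.+1] is the drop from [decay k.+1] to [decay k.+2]. *)
Lemma weighted_mean_path (d : nat) (S : 'M[R]_d) (a : 'cV[R]_d) (m h : nat -> 'cV[R]_d) k :
  m 0%N = 0 -> h 0%N = 0 ->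
  (forall k, m k.+1 = m k - eta k *: (S *m m k - a)) ->
  (forall k, h k.+1 = h k - g k *: (S *m h k - a + lam *: h k)) ->
  \sum_(i < k.+1) (pw lam eta i *: m i) = h k - decay k.+1 *: m k.
Proof.
move=> m0 h0 mS hS; elim: k => [|k IHk].
  by rewrite big_ord_recr big_ord0 /= m0 h0 !scaler0 subr0 addr0.
rewrite big_ord_recr -[X in _ + X = _]/(pw lam eta k.+1 *: m k.+1) [X in X + _]IHk.
rewrite pwE mS hS (mean_path_residual k m0 h0 mS hS).
move: (S *m m k - a) => D; apply/colP => i; rewrite !mxE.
rewrite (decayS k.+1); have := decayS_eta k; move: (decay k.+1) (decay k) => q' q qq.
have -> : g k * (q * D i 0) = q' * eta k * D i 0 by rewrite qq; ring.
ring.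
Qed.

End Weights.

(** * Chebyshev's inequality on tuples *)

Lemma chebyshev_tuple (R : realType) (n k : nat) (f : k.-tuple 'I_n -> R) (M delta : R) :
  (0 < n)%N -> 0 <= M -> 0 <= delta -> (forall t, 0 <= f t) ->
  Exp (fun t => f t ^+ 2 : R^o) <= delta * M ^+ 2 ->
  1 - delta <= Prob R [pred t | f t <= M].
Proof.
move=> n0 M0 delta0 f0 fM; set A := [pred t | f t <= M].
have N0 : 0 < (n ^ k)%:R :> R by rewrite ltr0n expn_gt0 n0.
have cA : #|A|%:R + #|[predC A]|%:R = (n ^ k)%:R :> R.
  by rewrite -natrD cardC card_tuple card_ord.
have fM' : \sum_t f t ^+ 2 <= delta * M ^+ 2 * (n ^ k)%:R.
  by rewrite -ler_pdivrMr// mulrC.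
rewrite /Prob ler_pdivlMr//.
(* If [M = 0] one cannot divide by [M ^+ 2]; the second moment is then zero, so [f] vanishes on
   every tuple. *)
move: M0; rewrite le_eqVlt => /predU1P[M0|M0].
  have /eqP h : \sum_t f t ^+ 2 == 0.
    rewrite eq_le sumr_ge0 ?andbT => [|t _]; last exact: sqr_ge0.
    by apply: le_trans fM' _; rewrite -M0 expr0n mulr0 mul0r.
  have -> : #|A|%:R = (n ^ k)%:R :> R.
    rewrite -cA; have -> : #|[predC A]| = 0%N; last by rewrite addr0.
    apply: eq_card0 => t; rewrite !inE; apply/negbTE; rewrite negbK.
    have /eqP : f t ^+ 2 = 0 by apply: (psumr_eq0P _ h) => // u _; exact: sqr_ge0.
    by rewrite sqrf_eq0 => /eqP ->; rewrite -M0.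
  by rewrite ger_pMl// lerBlDr lerDl.
have : #|[predC A]|%:R * M ^+ 2 <= \sum_t f t ^+ 2.
  rewrite mulr_natl -sumr_const [leRHS](bigID [in [predC A]]) /=.
  rewrite -[leLHS]addr0 lerD// ?sumr_ge0// => [|t _]; last exact: sqr_ge0.
  by apply: ler_sum => t; rewrite !inE -ltNge => /ltW tM; rewrite lerXn2r// nnegrE ?f0// ltW.
move=> /le_trans /(_ fM'); rewrite mulrAC ler_pM2r ?exprn_gt0//.
lra.
Qed.

(** * Second moments of weighted noise sums *)

Section WeightedDeviation.
Variables (R : realType) (n : nat) (lam : R) (eta : nat -> R).
Hypotheses (n0 : (0 < n)%N) (lam0 : 0 < lam) (eta_gt0 : forall k, 0 < eta k).
Local Notation g := (gammas lam eta).
Local Notation q := (decay lam eta).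

(* The extra term [q k * c * U t] anticipates the weight still to come on [U t];
   the bound [c <= lam / (lam + s)] is preserved because [lam / (lam + s)] is the
   fixed point of [c |-> lam * g k + (1 - g k * (lam + s)) * c]. *)
Lemma weighted_deviation (s : R) (U : seq 'I_n -> R) (e : seq 'I_n -> 'I_n -> R)
    (k : nat) (c : R) :
  0 < lam + s -> (forall k, g k * (lam + s) <= 1) -> U [::] = 0 ->
  (forall t i, U (rcons t i) = (1 - eta (size t) * s) * U t + eta (size t) * e t i) ->
  (forall t, \sum_i e t i = 0) ->
  0 <= c <= lam / (lam + s) ->
  Exp (fun t : k.-tuple 'I_n =>
    (\sum_(j < k) pw lam eta j * U (take j t) + q k * c * U t) ^+ 2 : R^o) <=
  (lam / (lam + s)) ^+ 2 * \sum_(j < k) (q j * g j) ^+ 2 *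
     Exp (fun t : j.-tuple 'I_n => n%:R^-1 * \sum_i e t i ^+ 2 : R^o).
Proof.
move=> ls0 gs U0 US e0; elim: k c => [|k IHk] c /andP[c0 cl].
  by rewrite Exp0 /= !big_ord0 U0 !(mulr0, addr0) expr0n.
set rho := lam / (lam + s) in IHk cl *.
have gk0 := gamma_gt0 lam0 eta_gt0 k.
(* Substituting the recursion for the last [U] into the sum leaves [q k * c1] as the total weight on
   the previous [U] and [q k * g k * c] on the fresh noise. *)
pose c1 := lam * g k + (1 - g k * (lam + s)) * c.
have cbnd : 0 <= c1 <= rho.
  have h : 0 <= 1 - g k * (lam + s) by rewrite subr_ge0.
  apply/andP; split; first by rewrite addr_ge0 // mulr_ge0 // ltW.
  rewrite [leRHS](_ : rho = lam * g k + (1 - g k * (lam + s)) * rho); last first.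
    by rewrite /rho; field; rewrite gt_eqF.
  by rewrite lerD2l ler_wpM2l.
have {IHk} IH := IHk _ cbnd.
pose A (t : k.-tuple 'I_n) := \sum_(j < k) pw lam eta j * U (take j t) + q k * c1 * U t.
pose V (t : k.-tuple 'I_n) := n%:R^-1 * \sum_i e t i ^+ 2.
have -> : Exp (fun t : k.+1.-tuple 'I_n =>
    (\sum_(j < k.+1) pw lam eta j * U (take j t) + q k.+1 * c * U t) ^+ 2 : R^o) =
  Exp (fun t => A t ^+ 2 : R^o) + (q k * g k * c) ^+ 2 *: Exp (fun t => V t : R^o).
  rewrite -ExpZ -ExpD Exp_rcons; apply: eq_Exp => t.
  transitivity (n%:R^-1 * \sum_i (A t + q k * g k * c * e t i) ^+ 2).
    congr (_ * _); apply: eq_bigr => i _; congr (_ ^+ 2).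
    rewrite -[LHS]/(\sum_(j < k.+1) pw lam eta j * U (take j (rcons t i)) +
                    q k.+1 * c * U (rcons t i)).
    have -> : \sum_(j < k.+1) pw lam eta j * U (take j (rcons t i)) =
        \sum_(j < k) pw lam eta j * U (take j t) + q k * (lam * g k) * U t.
      rewrite big_ord_recr -pwE// -cats1; congr (_ + _ * U _).
        by apply: eq_bigr => j _; congr (_ * U _); rewrite takel_cat//= size_tuple ltnW.
      by rewrite takel_cat /= ?take_oversize ?size_tuple.
    rewrite US size_tuple.
    rewrite /A /c1; set Z := \sum_(j < k) _.
    have h := decayS_eta lam eta_gt0 k.
    have h1 := decayS lam0 eta_gt0 k.
    have -> : q k * g k * c * e t i = q k.+1 * eta k * c * e t i by rewrite h.
    have -> : q k.+1 * c * ((1 - eta k * s) * U t + eta k * e t i) =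
      (q k.+1 - (q k.+1 * eta k) * s) * c * U t + q k.+1 * eta k * c * e t i by ring.
    by rewrite h h1; ring.
  set B := q k * g k * c.
  (* Orthogonality: given [t], the noise sums to zero over [i], which removes the cross term. *)
  have -> : \sum_i (A t + B * e t i) ^+ 2 =
      n%:R * A t ^+ 2 + B ^+ 2 * \sum_i e t i ^+ 2.
    transitivity (\sum_i (A t ^+ 2 + 2 * A t * B * e t i + B ^+ 2 * e t i ^+ 2)).
      by apply: eq_bigr => i _; ring.
    rewrite !big_split /= sumr_const card_ord -[X in X + _ + _]mulr_natl.
    by rewrite -!mulr_sumr e0 mulr0 addr0.
  rewrite mulrDr mulKf ?pnatr_eq0 -?lt0n//; congr (_ + _).
  by rewrite /V -[RHS]/(B ^+ 2 * _) mulrCA.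
rewrite big_ord_recr /= mulrDr lerD//.
rewrite -[leLHS]/((q k * g k * c) ^+ 2 * Exp (fun t : k.-tuple 'I_n => V t : R^o)).
rewrite mulrA -exprMn ler_wpM2r//.
  rewrite /Exp -[leRHS]/(_ * _) mulr_ge0 ?invr_ge0 ?ler0n// sumr_ge0// => t _.
  rewrite mulr_ge0 ?invr_ge0 ?ler0n// sumr_ge0// => i _.
  exact: sqr_ge0.
have qg0 : 0 <= q k * g k by rewrite mulr_ge0 ?decay_ge0// ltW.
have rho0 : 0 <= rho by exact: le_trans cl.
apply: lerXn2r; rewrite ?nnegrE; [exact: mulr_ge0|exact: mulr_ge0|].
by rewrite mulrC ler_wpM2r.
Qed.

End WeightedDeviation.

(** * Variance of the averaged iterates *)

Section AveragedIterates.
Variables (R : realType) (n d : nat) (X : 'I_n -> 'cV[R]_d) (Y : 'I_n -> R).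
Variables (lam : R) (eta : nat -> R).
Hypotheses (n0 : (0 < n)%N) (lam0 : 0 < lam) (eta_gt0 : forall k, 0 < eta k).
Local Notation g := (gammas lam eta).
Local Notation q := (decay lam eta).
Local Notation m k := (Exp (fun t : k.-tuple 'I_n => sgd_path X Y eta 0 t)).

Lemma PwE k : Pw lam eta k = 1 - q k.+1. Proof. by []. Qed.

(** Since [decay k <= 1], the last factor alone already gives this. It keeps [P_k] away from zero
    uniformly in [k]. *)
Lemma Pw_ge_gamma k : lam * g k <= Pw lam eta k.
Proof.
have r0 j : 0 <= 1 - lam * g j.
  by rewrite -gamma_ratio// divr_ge0 ?(ltW (gamma_gt0 _ _ _))// ltW.
have q1 : q k <= 1.
  elim: k => [|k IHk]; first by rewrite /decay big_ord0.
  rewrite decayS// mulr_ile1 ?decay_ge0// lerBlDr lerDl mulr_ge0 ?ltW//.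
  exact: gamma_gt0.
rewrite PwE decayS//; have := ler_wpM2r (r0 k) q1; lra.
Qed.

Lemma Pw_gt0 k : 0 < Pw lam eta k.
Proof. by apply: lt_le_trans (Pw_ge_gamma k); rewrite mulr_gt0// gamma_gt0. Qed.

Lemma Pw_wtilde k (t : k.-tuple 'I_n) :
  Pw lam eta k *: wtilde X Y lam eta t =
  \sum_(i < k.+1) pw lam eta i *: sgd_path X Y eta 0 (take i t).
Proof. by rewrite /wtilde scalerA divff ?scale1r// gt_eqF// Pw_gt0. Qed.

Lemma Pw_Exp_wtilde k :
  Pw lam eta k *: Exp (fun t : k.-tuple 'I_n => wtilde X Y lam eta t) =
  \sum_(i < k.+1) pw lam eta i *: m i.
Proof.
rewrite -ExpZ; under eq_Exp do rewrite Pw_wtilde.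
rewrite Exp_sum; apply: eq_bigr => i _; rewrite ExpZ.
by rewrite (Exp_take (fun s => sgd_path X Y eta 0 s))// -ltnS ltn_ord.
Qed.

Lemma Exp_sqr_gnoise k :
  Exp (fun t : k.+1.-tuple 'I_n => norm2 (gnoise X Y eta t) ^+ 2 : R^o) =
  Exp (fun t : k.-tuple 'I_n => n%:R^-1 * \sum_i norm2 (Sigma X *m sgd_path X Y eta 0 t
    - avec X Y - sample_grad X Y i (sgd_path X Y eta 0 t)) ^+ 2 : R^o).
Proof.
rewrite Exp_rcons; apply: eq_Exp => t; congr (_ * _); apply: eq_bigr => i _.
rewrite /gnoise; have -> : tnth [tuple of rcons t i] ord_max = i.
  by rewrite (tnth_nth i) /= nth_rcons size_tuple ltnn eqxx.
by rewrite /= -cats1 takel_cat ?take_oversize ?size_tuple.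
Qed.

Lemma averaged_variance (p : nat) (F : 'M[R]_(p, d)) (s : 'I_p -> R) (alpha sigma : R) k :
  F^T *m F = 1%:M -> F *m Sigma X = diag_mx (\row_i s i) *m F ->
  0 < lam + alpha -> (forall i, alpha <= s i) ->
  (forall k i, g k * (lam + s i) <= 1) ->
  (forall k, Exp (fun t : k.+1.-tuple 'I_n => norm2 (gnoise X Y eta t) ^+ 2 : R^o)
             <= sigma ^+ 2) ->
  Exp (fun t : k.-tuple 'I_n => norm2 (Pw lam eta k *: wtilde X Y lam eta t -
    Pw lam eta k *: Exp (fun t : k.-tuple 'I_n => wtilde X Y lam eta t)) ^+ 2 : R^o)
  <= (lam / (lam + alpha)) ^+ 2 * \sum_(j < k) (q j * g j) ^+ 2 * sigma ^+ 2.
Proof.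
move=> FF FS la0 sa gs noise.
pose w (u : seq 'I_n) := sgd_path X Y eta 0 u.
(* [U i] is the centred path along frame vector [i]; [e i] is the gradient noise there, as a
   function of the past and of the next index. *)
pose U i (u : seq 'I_n) := (F *m (w u - m (size u))) i 0.
pose e i (u : seq 'I_n) (l : 'I_n) :=
  (F *m (Sigma X *m w u - avec X Y - sample_grad X Y l (w u))) i 0.
have gk0 := gamma_gt0 lam0 eta_gt0.
have ls0 i : 0 < lam + s i by apply: lt_le_trans la0 _; rewrite lerD2l.
have U0 i : U i [::] = 0.
  by rewrite /U /= Exp_sgd_path0 /w /= subr0 mulmx0 mxE.
have US i u l : U i (rcons u l) =
    (1 - eta (size u) * s i) * U i u + eta (size u) * e i u l.
  rewrite /U /e size_rcons Exp_sgd_pathS// /w sgd_path_rcons.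
  set z := sample_grad _ _ _ _; set x := sgd_path _ _ _ _ u; set y : 'cV[R]_d := m (size u).
  clearbody z x y.
  have -> : x - eta (size u) *: (z + 0 *: x) -
      (y - eta (size u) *: (Sigma X *m y - avec X Y + 0 *: y)) =
      (x - y) - eta (size u) *: (Sigma X *m (x - y)) +
      eta (size u) *: (Sigma X *m x - avec X Y - z).
    rewrite mulmxBr; apply/colP => r; rewrite !mxE; ring.
  move: (Sigma X *m x - avec X Y - z) (x - y) => D v.
  rewrite mulmxDr mulmxBr -!scalemxAr mulrBl mul1r -mulrA -(eigenframe_coord FS).
  by move: (F *m v) (F *m (Sigma X *m v)) (F *m D) => a1 a2 a3; rewrite !mxE.
have e0 i u : \sum_l e i u l = 0.
  rewrite /e -summxE -mulmx_sumr sumrB sumr_const card_ord.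
  rewrite -[X in X - _]scaler_nat -mean_sample_grad scalerA divff ?scale1r.
    by rewrite subrr mulmx0 mxE.
  by rewrite pnatr_eq0 -lt0n.
have coord (t : k.-tuple 'I_n) : norm2 (Pw lam eta k *: wtilde X Y lam eta t -
    Pw lam eta k *: Exp (fun t : k.-tuple 'I_n => wtilde X Y lam eta t)) ^+ 2 =
    \sum_i (\sum_(j < k) pw lam eta j * U i (take j t) + q k * (lam * g k) * U i t) ^+ 2.
  rewrite Pw_wtilde Pw_Exp_wtilde -sumrB -(norm2_isometry _ FF) sqr_norm2.
  apply: eq_bigr => i _; congr (_ ^+ 2); rewrite -pwE//.
  transitivity (\sum_(j < k.+1) pw lam eta j * U i (take j t)).
    rewrite mulmx_sumr summxE; apply: eq_bigr => j _.
    rewrite -scalerBr -scalemxAr mxE /U size_takel// size_tuple.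
    by rewrite -ltnS ltn_ord.
  by rewrite big_ord_recr; congr (_ + _ * U i _); rewrite take_oversize ?size_tuple.
under eq_Exp do rewrite coord.
rewrite (Exp_sum (V := R^o)).
have step i : Exp (fun t : k.-tuple 'I_n => (\sum_(j < k) pw lam eta j * U i (take j t) +
      q k * (lam * g k) * U i t) ^+ 2 : R^o) <=
    (lam / (lam + alpha)) ^+ 2 * \sum_(j < k) (q j * g j) ^+ 2 *
     Exp (fun t : j.-tuple 'I_n => n%:R^-1 * \sum_l e i t l ^+ 2 : R^o).
  (* The last weight is [pw k = q k * (lam * g k)], so the final iterate plays the part of the extra
     term with [c = lam * g k]. *)
  have c0 : 0 <= lam * g k <= lam / (lam + s i).
    apply/andP; split; first exact/ltW/mulr_gt0.
    by rewrite ler_pdivlMr// -mulrA -[leRHS]mulr1 ler_pM2l.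
  apply: le_trans (weighted_deviation n0 lam0 eta_gt0 k (ls0 i) (fun k => gs k i)
    (U0 i) (US i) (e0 i) c0) _.
  apply: ler_wpM2r.
    apply: sumr_ge0 => j _; rewrite mulr_ge0 ?sqr_ge0// /Exp -[leRHS]/(_ * _).
    rewrite mulr_ge0 ?invr_ge0 ?ler0n// sumr_ge0// => t _.
    by rewrite mulr_ge0 ?invr_ge0 ?ler0n// sumr_ge0// => l _; exact: sqr_ge0.
  apply: lerXn2r; rewrite ?nnegrE; [exact/ltW/divr_gt0|exact/ltW/divr_gt0|].
  by rewrite ler_wpM2l ?(ltW lam0)// lef_pV2 ?posrE// lerD2l.
(* Exchanging the sums reassembles the coordinate noises into the full norm, where the hypothesis on
   [sigma] applies. *)
apply: le_trans (ler_sum _ (fun i _ => step i)) _.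
rewrite -mulr_sumr ler_wpM2l ?sqr_ge0// exchange_big ler_sum// => j _.
rewrite -mulr_sumr ler_wpM2l ?sqr_ge0//.
apply: le_trans (noise j); rewrite Exp_sqr_gnoise -(Exp_sum (V := R^o)).
apply: le_Exp => t; rewrite -mulr_sumr ler_wpM2l ?invr_ge0// exchange_big ler_sum// => l _.
by rewrite -(norm2_isometry _ FF) sqr_norm2.
Qed.

End AveragedIterates.

(** * Geometric rates and the variance constant *)

Lemma geometric_squeeze (R : realType) (f : nat -> R) (r c : R) : 0 <= r < 1 ->
  (forall k, 0 <= f k <= r ^+ k * c) -> f @ \oo --> (0 : R).
Proof.
move=> /andP[r0 r1] fP; apply: (@squeeze_cvgr _ _ _ _ (fun=> 0) (fun k => r ^+ k * c)).
- by near=> k; exact: fP.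
- exact: cvg_cst.
- rewrite -(mul0r c); apply: cvgMl; apply: cvg_expr; by rewrite ger0_norm.
Unshelve. all: by end_near. Qed.

Lemma sumr_geometric_le (R : realType) (x : R) k : 0 <= x < 1 ->
  \sum_(j < k) x ^+ j <= (1 - x)^-1.
Proof.
move=> /andP[x0 x1]; have x1' : 0 < 1 - x by rewrite subr_gt0.
rewrite -[leRHS]mul1r ler_pdivlMr// mulrC.
have := subrX1 x k; have := exprn_ge0 k x0; nra.
Qed.

Lemma gradient_descent_geometric (R : realType) (p d : nat) (F : 'M[R]_(p, d))
    (S : 'M[R]_d) (s : 'I_p -> R) (c : 'cV[R]_d) (alpha tau0 : R) (tau : nat -> R)
    (v : nat -> 'cV[R]_d) :
  F^T *m F = 1%:M -> F *m S = diag_mx (\row_i s i) *m F ->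
  0 < alpha -> (forall i, alpha <= s i) -> 0 < tau0 -> (forall k, tau0 <= tau k) ->
  (forall k i, tau k * s i <= 1) ->
  (forall k, v k.+1 = v k - tau k *: (S *m v k - c)) ->
  exists2 r : R, 0 <= r < 1 & forall k,
    norm2 (v k - invmx S *m c) <= r ^+ k * norm2 (v 0%N - invmx S *m c).
Proof.
move=> FF FS a0 sa t0 tau_ge taus vS.
(* The maximum keeps the rate nonnegative even for an empty frame, where no eigenvalue bounds
   [tau0 * alpha]. *)
exists (Num.max 0 (1 - tau0 * alpha)).
  by rewrite le_max lexx gt_max ltr01 /= ltrBlDr ltrDl mulr_gt0.
(* The point [invmx S *m c] is fixed by every step, so the error follows the homogeneous
   recursion. *)
move=> k; apply: (@eigenframe_contraction _ _ _ _ _ _ FF FS _ tau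
  (fun k => v k - invmx S *m c)) => [|{}k i|{}k].
- by rewrite le_max lexx.
- rewrite ger0_norm ?subr_ge0// le_max lerD2l lerN2 ler_pM ?orbT//; exact: ltW.
- have Su : S \in unitmx.
    by apply: (eigenframe_unitmx FF FS) => i; rewrite gt_eqF// (lt_le_trans a0).
  by rewrite vS mulmxBr mulKVmx// addrAC.
Qed.

(* Uses [g j <= 1 / (lam + beta)] and [1 <= 1 / (gam * (lam + beta))]. *)
Lemma variance_bound (R : realType) (lam alpha beta gam sigma delta : R)
    (q g : nat -> R) k :
  0 < lam -> 0 < alpha -> 0 < beta -> 0 < gam -> gam * (lam + beta) <= 1 ->
  0 < delta -> (forall j, 0 <= g j) -> (forall j, g j * (lam + beta) <= 1) ->
  (forall j, 0 <= q j <= (1 - lam * gam) ^+ j) ->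
  (lam / (lam + alpha)) ^+ 2 * \sum_(j < k) (q j * g j) ^+ 2 * sigma ^+ 2 <=
  delta * (sigma / (gam * (lam + alpha) * (lam + beta) ^+ 2)
           * Num.sqrt (lam / (delta * gam * (2 - lam * gam)))) ^+ 2.
Proof.
move=> l0 a0 b0 gam0 gamb d0 g0 gb qP.
have lb0 : 0 < lam + beta by rewrite addr_gt0.
have la0 : 0 < lam + alpha by rewrite addr_gt0.
have lg0 : 0 < lam * gam by rewrite mulr_gt0.
have lg1 : lam * gam < 1 by nra.
have l2 : 0 < 2 - lam * gam by lra.
have r01 : 0 <= (1 - lam * gam) ^+ 2 < 1 by rewrite sqr_ge0/=; nra.
rewrite [X in delta * X]exprMn sqr_sqrtr; last by rewrite divr_ge0 ?mulr_ge0 ?(ltW l2) ?ltW.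
(* The last factor is the sum of the geometric series of ratio [(1 - lam * gam) ^+ 2]; it absorbs
   one [lam], leaving the single one under the root. *)
have -> : delta * ((sigma / (gam * (lam + alpha) * (lam + beta) ^+ 2)) ^+ 2 *
    (lam / (delta * gam * (2 - lam * gam)))) =
  (lam / (lam + alpha)) ^+ 2 * (sigma ^+ 2 * ((lam + beta)^-1 ^+ 2 *
   (gam * (lam + beta))^-1 ^+ 2 * (lam * gam * (2 - lam * gam))^-1)).
  by field; rewrite !gt_eqF.
rewrite ler_wpM2l ?sqr_ge0// -mulr_suml mulrC ler_wpM2l ?sqr_ge0//.
apply: (@le_trans _ _ (\sum_(j < k) (lam + beta)^-1 ^+ 2 * ((1 - lam * gam) ^+ 2) ^+ j)).
  apply: ler_sum => j _; have /andP[q0 qle] := qP j.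
  rewrite exprMn mulrC -exprM mulnC exprM ler_pM ?sqr_ge0// lerXn2r ?nnegrE ?g0//.
  - by rewrite invr_ge0 ltW.
  - by rewrite -[leRHS]mul1r ler_pdivlMr.
  - exact: le_trans qle.
rewrite -mulr_sumr -mulrA ler_wpM2l ?sqr_ge0//.
apply: le_trans (sumr_geometric_le k r01) _.
have -> : 1 - (1 - lam * gam) ^+ 2 = lam * gam * (2 - lam * gam) by ring.
rewrite -[leLHS]mul1r; apply: ler_wpM2r; first by rewrite invr_ge0 ltW// mulr_gt0.
by rewrite exprn_ege1// invf_ge1// mulr_gt0.
Qed.

(** * Assembly of the three claims *)

Theorem theorem1 (R : realType) (n d : nat) (X : 'I_n -> 'cV[R]_d) (Y : 'I_n -> R)
  (alpha beta lam eta0 : R) (eta : nat -> R) :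
  (0 < n)%N ->
  0 < alpha ->
  (forall e : R, eigenvalue (Sigma X) e -> alpha <= e /\ e <= beta) ->
  0 < lam ->
  0 < eta0 ->
  (forall k, eta0 <= eta k /\ eta k < beta^-1) ->
  let gam := eta0 / (1 + lam * eta0) in
  let w := fun k (t : k.-tuple 'I_n) => sgd_path X Y eta 0 t in
  let what := fun k (t : k.-tuple 'I_n) => sgd_path X Y (gammas lam eta) lam t in
  let wt := fun k (t : k.-tuple 'I_n) => wtilde X Y lam eta t in
  (* 1. *)
  (forall k, Pw lam eta k *: Exp (wt k)
             = Exp (what k) - (1 - Pw lam eta k) *: Exp (w k))
  (* 2. *)
  /\ ((fun k => norm2 (Exp (w k) - invmx (Sigma X) *m avec X Y)) @ \oo --> (0 : R))
  /\ ((fun k => norm2 (Exp (what k) - invmx (Sigma X + lam%:M) *m avec X Y))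
        @ \oo --> (0 : R))
  /\ (exists C : R, forall k,
        norm2 (Exp (what k) - Exp (wt k)) <= C * (1 - lam * gam) ^+ k)
  (* 3. *)
  /\ (forall sigma : R, 0 <= sigma ->
        (forall k, Exp (fun t : k.+1.-tuple 'I_n => norm2 (gnoise X Y eta t) ^+ 2)
                   <= sigma ^+ 2) ->
        forall delta : R, 0 < delta < 1 ->
        exists K : nat, forall k, (K <= k)%N ->
          Prob R [pred t : k.-tuple 'I_n |
                 norm2 (Pw lam eta k *: wt k t - Pw lam eta k *: Exp (wt k))
                 <= sigma / (gam * (lam + alpha) * (lam + beta) ^+ 2)
                    * Num.sqrt (lam / (delta * gam * (2 - lam * gam)))]
          >= 1 - delta).
Proof.
move=> n0 a0 eig lam0 e00 etaP gam w what wt.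
have eta_ge k : eta0 <= eta k by case: (etaP k).
have eta_gt0 k : 0 < eta k by exact: lt_le_trans e00 (eta_ge k).
(* Positivity of [beta] comes from the step sizes: [0 < eta 0 < beta^-1]. *)
have b0 : 0 < beta.
  by rewrite -invr_gt0; have [_] := etaP 0%N; apply: lt_trans.
have etab k : eta k * beta <= 1.
  by have [_ /ltW] := etaP k; rewrite -[_^-1]mul1r ler_pdivlMr.
have gb x : 0 < x -> x * beta <= 1 -> x / (1 + lam * x) * (lam + beta) <= 1.
  move=> x0 xb; rewrite mulrAC ler_pdivrMr ?addr_gt0 ?mulr_gt0//; lra.
have [F [s [FF FS sE]]] := symmetric_eigenframe (Sigma_sym X).
have sa i : alpha <= s i by case: (eig _ (sE i)).
have sb i : s i <= beta by case: (eig _ (sE i)).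
have g0 := gamma_gt0 lam0 eta_gt0.
have ggb k : gammas lam eta k * (lam + beta) <= 1 by exact: gb.
have gs k i : gammas lam eta k * (lam + s i) <= 1.
  by apply: le_trans (ggb k); rewrite ler_pM2l// lerD2l.
have gam0 : 0 < gam by rewrite divr_gt0// addr_gt0// mulr_gt0.
have gamb : gam * (lam + beta) <= 1.
  by apply: gb => //; apply: le_trans (etab 0%N); rewrite ler_wpM2r// ltW.
have gam_le k : gam <= gammas lam eta k.
  rewrite ler_pdivrMr ?addr_gt0 ?mulr_gt0// mulrAC ler_pdivlMr ?addr_gt0 ?mulr_gt0//.
  by have := eta_ge k; lra.
have mS k : Exp (w k.+1) = Exp (w k) - eta k *: (Sigma X *m Exp (w k) - avec X Y).
  by rewrite /w Exp_sgd_pathS// scale0r addr0.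
have hS k : Exp (what k.+1) = Exp (what k) -
    gammas lam eta k *: (Sigma X *m Exp (what k) - avec X Y + lam *: Exp (what k)).
  by rewrite /what Exp_sgd_pathS.
have m0 : Exp (w 0%N) = 0 by exact: Exp_sgd_path0.
have h0 : Exp (what 0%N) = 0 by exact: Exp_sgd_path0.
have part1 k : Pw lam eta k *: Exp (wt k) =
    Exp (what k) - (1 - Pw lam eta k) *: Exp (w k).
  rewrite Pw_Exp_wtilde// PwE subKr.
  exact: (weighted_mean_path lam0 eta_gt0 (m := fun k => Exp (w k))
           (h := fun k => Exp (what k)) k m0 h0 mS hS).
have [r1 r1P mcvg] := gradient_descent_geometric FF FS a0 sa e00 eta_ge
  (fun k i => le_trans (ler_wpM2l (ltW (eta_gt0 k)) (sb i)) (etab k)) mS.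
(* The same frame diagonalizes the regularized Hessian, with the spectrum shifted by [lam]. *)
have FSl : F *m (Sigma X + lam%:M) = diag_mx (\row_i (lam + s i)) *m F.
  rewrite mulmxDr FS mul_mx_scalar; apply/matrixP => i j.
  by rewrite !mul_diag_mx !mxE mulrDl addrC.
have la0 : 0 < lam + alpha by rewrite addr_gt0.
have sal i : lam + alpha <= lam + s i by rewrite lerD2l.
have hS' k : Exp (what k.+1) = Exp (what k) -
    gammas lam eta k *: ((Sigma X + lam%:M) *m Exp (what k) - avec X Y).
  by rewrite hS mulmxDl mul_scalar_mx addrAC.
have [r2 r2P hcvg] := gradient_descent_geometric FF FSl la0 sal gam0 gam_le gs hS'.
split=> //; split; [|split; [|split]].
- by apply: geometric_squeeze r1P _ => k; apply/andP; split; [exact: norm2_ge0|exact: mcvg].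
- by apply: geometric_squeeze r2P _ => k; apply/andP; split; [exact: norm2_ge0|exact: hcvg].
- set ws := invmx (Sigma X) *m _ in mcvg; set hs := invmx _ *m _ in hcvg.
  pose c1 := norm2 (Exp (w 0%N) - ws); pose c2 := norm2 (Exp (what 0%N) - hs).
  pose B := 2 * (c1 + 2 * (norm2 (ws - hs) + c2)).
  (* Both mean paths stay within their initial distance of their limits, so their gap is bounded
     uniformly in [k]. *)
  have bnd k : norm2 (Exp (w k) - Exp (what k)) <= B.
    have -> : Exp (w k) - Exp (what k) =
        (Exp (w k) - ws) + ((ws - hs) + (-1) *: (Exp (what k) - hs)).
      by rewrite scaleN1r opprB addrA subrKA addrA subrK.
    apply: le_trans (norm2D_le _ _) _; rewrite ler_pM2l// lerD//.
      apply: le_trans (mcvg k) _; rewrite ler_piMl ?norm2_ge0//.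
      by case/andP: r1P => r0 /ltW; exact: exprn_ile1.
    apply: le_trans (norm2D_le _ _) _; rewrite ler_pM2l// lerD2l norm2Z normrN1 mul1r.
    apply: le_trans (hcvg k) _; rewrite ler_piMl ?norm2_ge0//.
    by case/andP: r2P => r0 /ltW; exact: exprn_ile1.
  exists (B / (lam * gam)) => k.
  have P0 := Pw_gt0 lam0 eta_gt0 k.
  (* By the first claim, [P_k] times the left side is [1 - P_k] times the gap between the two mean
     paths; all the decay sits in this weight. *)
  have -> : Exp (what k) - Exp (wt k) =
      ((Pw lam eta k)^-1 * decay lam eta k.+1) *: (Exp (w k) - Exp (what k)).
    rewrite -scalerA -[LHS](scalerK (lt0r_neq0 P0)) scalerBr part1 PwE subKr.
    congr (_ *: _); apply/colP => i; rewrite !mxE; ring.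
  have B0 : 0 <= B := le_trans (norm2_ge0 _) (bnd k).
  have q0 := decay_ge0 lam0 eta_gt0 k.+1.
  rewrite norm2Z ger0_norm; last by rewrite mulr_ge0// invr_ge0 ltW.
  have lg0 : 0 < lam * gam by rewrite mulr_gt0.
  have r01 : 0 <= 1 - lam * gam <= 1 by nra.
  (* The product has [k.+1] factors; one of them is bounded by 1 to reach the exponent [k]. *)
  have qr : decay lam eta k.+1 <= (1 - lam * gam) ^+ k.
    apply: le_trans (decay_le lam0 eta_gt0 k.+1 e00 eta_ge) _.
    rewrite -/gam exprS ler_piMl//; last by case/andP: r01.
    by rewrite exprn_ge0//; case/andP: r01.
  have Pinv : (Pw lam eta k)^-1 <= (lam * gam)^-1.
    rewrite lef_pV2 ?posrE//; apply: le_trans (Pw_ge_gamma lam0 eta_gt0 k).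
    by rewrite ler_pM2l.
  rewrite [leRHS](_ : _ = (lam * gam)^-1 * (1 - lam * gam) ^+ k * B); last by ring.
  apply: ler_pM; rewrite ?norm2_ge0 ?bnd//.
    by rewrite mulr_ge0// invr_ge0 ltW.
  by apply: ler_pM; rewrite // invr_ge0 ltW.
- move=> sigma sig0 noise delta /andP[d0 d1]; exists 0%N => k _.
  apply: chebyshev_tuple => //; [|exact: ltW|by move=> t; exact: norm2_ge0|].
    rewrite mulr_ge0 ?sqrtr_ge0// divr_ge0// ltW//.
    by apply: mulr_gt0; [exact: mulr_gt0|apply: exprn_gt0; exact: addr_gt0].
  apply: le_trans (averaged_variance n0 lam0 eta_gt0 k FF FS la0 sa gs noise) _.
  apply: variance_bound => // j; first exact: ltW.
  rewrite decay_ge0//=; exact: decay_le.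
Qed.
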